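(* Let $\mathbb{T}$ be a time scale that is unbounded above and has bounded graininess $\mu$, let $t_0<t_f$ be points of $\mathbb{T}$, and let $A(t)\in\mathbb{R}^{n\times n}$, $B(t)\in\mathbb{R}^{n\times m}$, $C(t)\in\mathbb{R}^{p\times n}$, $D(t)\in\mathbb{R}^{p\times m}$ be rd-continuous matrix functions on $\mathbb{T}$ with $p,m\le n$ and $A$ regressive. Suppose $q$ is a positive integer such that, for $t\in[t_0,t_f]$, $B(t)$ is $q$-times rd-continuously differentiable and both $\mu(t)$ and $A(t)$ are $(q-1)$-times rd-continuously differentiable. Then the regressive linear system $$x^{\Delta}(t)=A(t)x(t)+B(t)u(t),\quad x(t_0)=x_0,\qquad y(t)=C(t)x(t)+D(t)u(t),$$ is controllable on $[t_0,t_f]$ if for some $t_c\in[t_0,t_f)$ we have $$\mathrm{rank}\begin{bmatrix}K_0(t_c)&K_1(t_c)&\cdots&K_q(t_c)\end{bmatrix}=n,$$ where $$K_j(t)=\frac{\partial^j}{\Delta s^j}\left[\Phi_{A}(\sigma(t),\sigma(s))B(s)\right]\Big|_{s=t},\qquad j=0,1,\dots,q.$$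
   Context: A time scale $\mathbb{T}$ is a nonempty closed subset of $\mathbb{R}$, with forward jump operator $\sigma(t)=\inf\{s\in\mathbb{T}:s>t\}$ and graininess $\mu(t)=\sigma(t)-t$; $f^\Delta$ denotes the delta derivative, and $\partial^j/\Delta s^j$ the $j$-th partial delta derivative in the variable $s$. Differentiability is in the delta sense; ''$k$-times rd-continuously differentiable'' means the delta derivatives up to order $k$ exist and are rd-continuous. Intervals are understood to be intersected with $\mathbb{T}$. A function is rd-continuous if it is continuous at right-dense points of $\mathbb{T}$ and has finite left limits at left-dense points. $A$ is regressive if $I+\mu(t)A(t)$ is invertible for all $t\in\mathbb{T}$. $\Phi_A(t,s)$ is the transition matrix: the unique solution $X(t)$ of $X^\Delta(t)=A(t)X(t)$, $X(s)=I$. The system is controllable on $[t_0,t_f]$ if for every initial state $x_0\in\mathbb{R}^n$ and every prescribed final state $x_f\in\mathbb{R}^n$ there exists an rd-continuous input $u(t)$ such that the corresponding solution satisfies $x(t_f)=x_f$.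
   Formalization: The formal theorem adds the condition σ^q(t_c) < t_f (q-fold forward jump of t_c), automatic if t_c is right-dense or t_f left-dense; without it the claim fails, e.g. T=Z, t_0=t_c=0, t_f=1, q=1, A=0, B(0)=e_1, B(t)=e_2 otherwise. *)

(* Defs.v *)
From mathcomp Require Import all_boot all_order all_algebra.
From mathcomp Require Import all_classical all_reals all_analysis.

Set Implicit Arguments.
Unset Strict Implicit.
Unset Printing Implicit Defensive.

Import Order.TTheory GRing.Theory Num.Theory.
Import numFieldNormedType.Exports.

Local Open Scope classical_set_scope.
Local Open Scope ring_scope.

(* Functions on a time scale T are represented by functions on R; every notion
   below only depends on their values at points of T. *)

Section TimeScale.
Variables (R : realType) (T : set R).
Implicit Types (t s l : R) (f g : R -> R) (I : set R).

Definition time_scale : Prop := T !=set0 /\ closed T.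

Definition unbounded_above : Prop := forall M : R, exists2 t, T t & M < t.

(* [inf set0] and [sup set0] are 0 in the library.  The infimum below is over a
   nonempty set as soon as T is unbounded above; the supremum in [rho] is over
   the empty set at t = min T, which is why [left_dense] excludes that point. *)
Definition sigma t : R := inf [set s | T s /\ t < s].
Definition rho t : R := sup [set s | T s /\ s < t].
Definition mu t : R := sigma t - t.

Definition bounded_graininess : Prop := exists M : R, forall t, T t -> mu t <= M.

Definition right_dense t : Prop := sigma t = t.
Definition left_dense t : Prop := (exists2 s, T s & s < t) /\ rho t = t.

(* l is the (Hilger) delta derivative of f at t. *)
Definition delta_deriv f t l : Prop :=
  forall eps : R, 0 < eps ->
    \forall s \near within T (nbhs t),
      `|f (sigma t) - f s - l * (sigma t - s)| <= eps * `|sigma t - s|.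

(* l is the k-th delta derivative of f at t.  The derivative of order k only
   has to exist at t; the one of order k - 1 has to exist at the points of T
   near t and at sigma t, which is what differentiating it at t involves. *)
Fixpoint delta_derivn k f t l : Prop :=
  if k is k'.+1 then
    exists g, [/\ \forall s \near within T (nbhs t), delta_derivn k' f s (g s),
                  delta_derivn k' f (sigma t) (g (sigma t))
                & delta_deriv g t l]
  else l = f t.

(* Rd-continuity on the points of T in I, with limits along those points.  If t
   has no point of T `&` I on its left, the filter of the second clause is the
   improper one and the clause holds trivially. *)
Definition rd_continuous I f : Prop :=
  (forall t, T t -> I t -> right_dense t ->
     f s @[s --> within (T `&` I) (nbhs t)] --> f t) /\
  (forall t, T t -> I t -> left_dense t ->
     exists l, f s @[s --> within (T `&` I `&` [set s | s < t]) (nbhs t)] --> l).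

Definition rd_differentiable I k f : Prop :=
  forall j, (j <= k)%N ->
    exists2 g, (forall t, T t -> I t -> delta_derivn j f t (g t))
             & rd_continuous I g.

(* For matrix functions, all these notions are entrywise. *)
Section Matrix.
Variables (n m : nat).
Implicit Types (F : R -> 'M[R]_(n, m)) (L : 'M[R]_(n, m)).

Definition mx_delta_deriv F t L : Prop :=
  forall i j, delta_deriv (fun s => F s i j) t (L i j).

Definition mx_delta_derivn k F t L : Prop :=
  forall i j, delta_derivn k (fun s => F s i j) t (L i j).

Definition mx_rd_continuous I F : Prop :=
  forall i j, rd_continuous I (fun s => F s i j).

Definition mx_rd_differentiable I k F : Prop :=
  forall i j, rd_differentiable I k (fun s => F s i j).

End Matrix.

Definition regressive n (A : R -> 'M[R]_n) : Prop :=
  forall t, T t -> 1%:M + mu t *: A t \in unitmx.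

Definition transition_matrix n (A : R -> 'M[R]_n) (Phi : R -> R -> 'M[R]_n) :
    Prop :=
  forall s, T s ->
    Phi s s = 1%:M /\
    forall t, T t -> mx_delta_deriv (fun r => Phi r s) t (A t *m Phi t s).

Section System.
Variables (n m p : nat).
Variables (A : R -> 'M[R]_n) (B : R -> 'M[R]_(n, m)).
Variables (C : R -> 'M[R]_(p, n)) (D : R -> 'M[R]_(p, m)).

Definition trajectory t0 (x0 : 'cV[R]_n) (u : R -> 'cV[R]_m)
    (x : R -> 'cV[R]_n) (y : R -> 'cV[R]_p) : Prop :=
  [/\ x t0 = x0,
      forall t, T t -> mx_delta_deriv x t (A t *m x t + B t *m u t)
    & forall t, T t -> y t = C t *m x t + D t *m u t].

Definition controllable t0 tf : Prop :=
  forall x0 xf : 'cV[R]_n,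
    exists (u : R -> 'cV[R]_m) (x : R -> 'cV[R]_n) (y : R -> 'cV[R]_p),
      [/\ mx_rd_continuous setT u, trajectory t0 x0 u x y & x tf = xf].

(* L is the value of K_j at t:  the j-th partial delta derivative with respect
   to s of Phi(sigma(t), sigma(s)) B(s), at s = t. *)
Definition is_K (Phi : R -> R -> 'M[R]_n) (j : nat) t (L : 'M[R]_(n, m)) :
    Prop :=
  mx_delta_derivn j (fun s => Phi (sigma t) (sigma s) *m B s) t L.

End System.

End TimeScale.

(* Main.v *)
(** Put G(s) = Phi(t0, sigma(s)) B(s) and let W be the antiderivative of G G^T
    with W(t0) = 0.  If W(tf) is invertible, the input u = G^T W(tf)^-1 zeta
    with zeta = Phi(t0, tf) xf - x0 steers x0 to xf along
    x = Phi(., t0) (x0 + W W(tf)^-1 zeta).  If v W(tf) = 0, then v W v^T has the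
    nonnegative derivative |v G|^2 and equal values at t0 and tf, so v G = 0 on
    [t0, tf[.  As Phi(sigma(tc), sigma(s)) B(s) = Phi(sigma(tc), t0) G(s), the
    row v Phi(t0, sigma(tc)) then annihilates every K_j(tc), because the
    derivatives at tc only depend on the values on [tc, tf[; hence v = 0. *)

Require Import Defs.
From mathcomp Require Import all_boot all_order all_algebra.
From mathcomp Require Import all_classical all_reals all_analysis.
From mathcomp Require Import ring lra.

Set Implicit Arguments.
Unset Strict Implicit.
Unset Printing Implicit Defensive.

Import Order.TTheory GRing.Theory Num.Theory.
Import numFieldNormedType.Exports.

Local Open Scope classical_set_scope.
Local Open Scope ring_scope.

(** [Phi] is known only through its equation in the first argument, whereas G needs the second one.
    The bridge is uniqueness for the homogeneous system on all of T, to the left as well as to the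
    right; regressivity is what carries a zero backwards over a gap. Uniqueness gives the cocycle
    identity, so [Phi t0 (sigma s)] is an inverse matrix and inherits rd-continuity from
    [Phi (sigma s) t0]. The [sigma s] in G is dictated by the product rule, which multiplies the
    derivative of the second factor by the first factor at [sigma t]. A trajectory has to satisfy
    the equation at every point of T, so W must be differentiable on all of T; it is a Lebesgue
    integral of G G^T extended as a constant over the gaps. A derivative of order j at tc samples
    the function up to the j-th iterate of [sigma] at tc; the condition [iter q (sigma T) tc < tf]
    keeps these samples where v G is known to vanish. *)

Lemma near_withinP (R : realType) (A : set R) (t : R) (P : R -> Prop) :
  (\forall s \near within A (nbhs t), P s) <->
  exists2 d : R, 0 < d & forall s, A s -> `|s - t| < d -> P s.
Proof.
split.
  rewrite near_withinE => -[d /= d0 H]; exists d => // s As st.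
  by apply: H => //=; rewrite distrC.
move=> [d d0 H]; rewrite near_withinE; exists d => //= s /= st As.
by apply: H => //; rewrite distrC.
Qed.

Lemma cvg_withinP (R : realType) (A : set R) (t : R) (f : R -> R) (l : R) :
  (f s @[s --> within A (nbhs t)] --> l) <->
  (forall e : R, 0 < e ->
     \forall s \near within A (nbhs t), `|f s - l| <= e).
Proof.
split=> [H e e0|H].
  move/cvgrPdist_le : H => /(_ _ e0) H; near=> s; rewrite distrC.
  by near: s; exact: H.
apply/cvgrPdist_le => e e0; near=> s; rewrite distrC.
by near: s; exact: H.
Unshelve. all: by end_near. Qed.

(** * Jumps, dense points and induction on a time scale *)

Section TimeScaleTheory.
Variables (R : realType) (T : set R).
Hypotheses (T_closed : closed T) (T_ub : unbounded_above T).
Implicit Types (r s t : R).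

Local Notation sigma := (sigma T).
Local Notation mu := (mu T).

Let up_nonempty t : [set s | T s /\ t < s] !=set0.
Proof. by have [s Ts ts] := T_ub t; exists s. Qed.

Let up_has_inf t : has_inf [set s | T s /\ t < s].
Proof. by split; [exact: up_nonempty | exists t => s [_ /ltW]]. Qed.

Lemma sigma_ge t : t <= sigma t.
Proof. by apply: lb_le_inf => // s [_ /ltW]. Qed.

Lemma sigma_le t s : T s -> t < s -> sigma t <= s.
Proof. by move=> Ts ts; apply: ge_inf => //; case: (up_has_inf t). Qed.

Lemma sigma_adherent t e : 0 < e ->
  exists s, [/\ T s, t < s & s < sigma t + e].
Proof.
by move=> e0; have [s [Ts ts] se] := inf_adherent e0 (up_has_inf t); exists s.
Qed.

Lemma sigma_in t : T (sigma t).
Proof.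
apply: T_closed => U /nbhs_ballP[e /= e0 eU].
have [s [Ts ts se]] := sigma_adherent t e0.
exists s; split => //; apply: eU; rewrite /ball/= ltr_norml.
by have := sigma_le Ts ts; lra.
Qed.

Lemma no_point_before_sigma t s : T s -> t < s -> s < sigma t -> False.
Proof. by move=> Ts ts; rewrite ltNge sigma_le. Qed.

Lemma mu_ge0 t : 0 <= mu t.
Proof. by rewrite subr_ge0 sigma_ge. Qed.

Lemma right_denseVscattered t : right_dense T t \/ t < sigma t.
Proof.
have := sigma_ge t; rewrite le_eqVlt => /orP[/eqP tE|]; last by right.
by left; rewrite /right_dense -tE.
Qed.

Lemma right_dense_adherent t e : right_dense T t -> 0 < e ->
  exists s, [/\ T s, t < s & s < t + e].
Proof. by move=> td e0; have := sigma_adherent t e0; rewrite td. Qed.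

(* sup set0 = 0 in the library, whence the witness [r]. *)
Lemma rho_props t r : T r -> r < t ->
  [/\ T (rho T t), rho T t <= t & forall s, T s -> s < t -> s <= rho T t].
Proof.
move=> Tr rt; set E := [set s | T s /\ s < t].
have E0 : E !=set0 by exists r.
have Eub : ubound E t by move=> s [_ /ltW].
have Esup : has_sup E by split=> //; exists t.
split.
- apply: T_closed; apply: (@closure_subset _ E) => [s []//|].
  by apply: closure_sup => //; exists t.
- exact: ge_sup.
- by move=> s Ts st; apply: ub_le_sup => //; case: Esup.
Qed.

Lemma left_scattered_pred t : ~ left_dense T t ->
  (forall s, T s -> t <= s) \/
  exists r, [/\ T r, r < t & forall s, T s -> s < t -> s <= r].
Proof.
move=> nld; case: (pselect (exists2 s, T s & s < t)) => [[r Tr rt]|nex].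
  right; exists (rho T t); have [Trho rhot H] := rho_props Tr rt; split=> //.
  rewrite lt_neqAle rhot andbT; apply/eqP => e; apply: nld; split=> //.
  by exists r.
by left=> s Ts; rewrite leNgt; apply/negP => st; apply: nex; exists s.
Qed.

Lemma left_dense_adherent t e : left_dense T t -> 0 < e ->
  exists s, [/\ T s, t - e < s & s < t].
Proof.
move=> [[r Tr rt] rhot] e0.
have Esup : has_sup [set s | T s /\ s < t].
  by split; [exists r|exists t => s [_ /ltW]].
have [s [Ts st] ts] := sup_adherent e0 Esup.
by exists s; split => //; rewrite -[X in X - _]rhot.
Qed.

(** Both induction principles below reach a left-scattered point in this way, by a jump from its
    predecessor. *)
Lemma sigma_pred r t : T t -> r < t -> (forall s, T s -> s < t -> s <= r) ->
  sigma r = t.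
Proof.
move=> Tt rt H; apply/eqP; rewrite eq_le sigma_le //=.
apply: lb_le_inf => // s [Ts rs]; rewrite leNgt; apply/negP => st.
by have := H _ Ts st; lra.
Qed.

Lemma no_near_left t : ~ left_dense T t ->
  exists2 d : R, 0 < d & forall s, T s -> `|s - t| < d -> t <= s.
Proof.
move=> /left_scattered_pred[H|[r [Tr rt H]]]; first by exists 1 => // s Ts _; exact: H.
exists (t - r); first lra.
move=> s Ts; rewrite ltr_norml => sd; rewrite leNgt; apply/negP => st.
by have := H _ Ts st; lra.
Qed.

Lemma no_near_right t : t < sigma t ->
  exists2 d : R, 0 < d & forall s, T s -> `|s - t| < d -> s <= t.
Proof.
move=> ts; exists (sigma t - t); first lra.
move=> s Ts; rewrite ltr_norml => sd; rewrite leNgt; apply/negP => st.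
by have := sigma_le Ts st; lra.
Qed.

(** A failure would have a nearest point [c] to [a], itself a failure because [S] is open. Seen from
    [a], either [c] is a limit of points of [S], which the openness of the complement excludes, or a
    gap precedes it, which the jump condition excludes. *)
Lemma time_scale_connected (S : R -> Prop) (a : R) :
  T a -> S a ->
  (forall t, T t -> S t -> \forall s \near within T (nbhs t), S s) ->
  (forall t, T t -> ~ S t -> \forall s \near within T (nbhs t), ~ S s) ->
  (forall t, T t -> S t <-> S (sigma t)) ->
  forall t, T t -> S t.
Proof.
move=> Ta Sa Sopen Sclosed Ssigma b Tb; apply: contrapT => nSb.
have : a != b by apply: contra_notN nSb => /eqP <-.
case/lt_total/orP => ab.
- set F := [set s | [/\ T s, a <= s & ~ S s]].
  have Fb : F b by split=> //; exact: ltW.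
  have Finf : has_inf F by split; [exists b|exists a => s []].
  pose c := inf F.
  have Flb s : F s -> c <= s by apply: ge_inf; case: Finf.
  have ac : a <= c by apply: lb_le_inf => [|s []//]; exists b.
  have Fadh e : 0 < e -> exists2 s, F s & s < c + e by move=> e0; exact: inf_adherent.
  have Tc : T c.
    apply: T_closed => U /nbhs_ballP[e /= e0 eU].
    have [s Fs se] := Fadh _ e0; have := Flb _ Fs.
    exists s; split; first by case: Fs.
    by apply: eU; rewrite /ball/= ltr_norml; lra.
  have nSc : ~ S c.
    move=> Sc; have /near_withinP[d d0 H] := Sopen _ Tc Sc.
    have [s Fs sd] := Fadh _ d0; have cs := Flb _ Fs.
    case: Fs => Ts _; apply; apply: H => //; rewrite ltr_norml; lra.
  have ltac : a < c.
    by rewrite lt_neqAle ac andbT; apply: contra_notN nSc => /eqP <-.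
  have below s : T s -> a <= s -> s < c -> S s.
    move=> Ts as_ sc; apply: contrapT => nSs.
    by have := Flb s (And3 Ts as_ nSs); lra.
  have /near_withinP[d d0 H] := Sclosed _ Tc nSc.
  have nld : ~ left_dense T c.
    move=> ld; have e0 : 0 < Num.min d (c - a) by rewrite lt_min d0 subr_gt0.
    have [s [Ts cs sc]] := left_dense_adherent ld e0.
    have : Num.min d (c - a) <= d /\ Num.min d (c - a) <= c - a.
      by rewrite !ge_min !lexx orbT.
    move=> [m1 m2]; have sd : `|s - c| < d by rewrite ltr_norml; lra.
    by apply: (H s Ts sd); apply: below => //; lra.
  have [Hmin|[r [Tr rc Hr]]] := left_scattered_pred nld.
    by have := Hmin _ Ta; lra.
  apply: nSc; rewrite -(sigma_pred Tc rc Hr); apply: (Ssigma r Tr).1.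
  by apply: below => //; exact: Hr.
- set F := [set s | [/\ T s, s <= a & ~ S s]].
  have Fb : F b by split=> //; exact: ltW.
  have Fsup : has_sup F by split; [exists b|exists a => s []].
  pose c := sup F.
  have Fub s : F s -> s <= c by apply: ub_le_sup; case: Fsup.
  have ca : c <= a by apply: ge_sup => [|s []//]; exists b.
  have Fadh e : 0 < e -> exists2 s, F s & c - e < s by move=> e0; exact: sup_adherent.
  have Tc : T c.
    apply: T_closed => U /nbhs_ballP[e /= e0 eU].
    have [s Fs se] := Fadh _ e0; have := Fub _ Fs.
    exists s; split; first by case: Fs.
    by apply: eU; rewrite /ball/= ltr_norml; lra.
  have nSc : ~ S c.
    move=> Sc; have /near_withinP[d d0 H] := Sopen _ Tc Sc.
    have [s Fs sd] := Fadh _ d0; have cs := Fub _ Fs.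
    case: Fs => Ts _; apply; apply: H => //; rewrite ltr_norml; lra.
  have ltca : c < a.
    by rewrite lt_neqAle ca andbT; apply: contra_notN nSc => /eqP ->.
  have above s : T s -> s <= a -> c < s -> S s.
    move=> Ts as_ sc; apply: contrapT => nSs.
    by have := Fub s (And3 Ts as_ nSs); lra.
  have /near_withinP[d d0 H] := Sclosed _ Tc nSc.
  have [rd|rs] := right_denseVscattered c.
    have e0 : 0 < Num.min d (a - c) by rewrite lt_min d0 subr_gt0.
    have [s [Ts cs sc]] := right_dense_adherent rd e0.
    have : Num.min d (a - c) <= d /\ Num.min d (a - c) <= a - c.
      by rewrite !ge_min !lexx orbT.
    move=> [m1 m2]; have sd : `|s - c| < d by rewrite ltr_norml; lra.
    by apply: (H s Ts sd); apply: above => //; lra.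
  (* Travelling left, the gap is crossed from [sigma c] back to [c]: for linear systems this half of
     the jump condition comes from regressivity. *)
  apply: nSc; apply: (Ssigma c Tc).2; apply: above => //.
  - exact: sigma_in.
  - exact: sigma_le.
Qed.

(** The classical induction principle for time scales, cut to [[a, b]]. A left-scattered point has
    no clause of its own, being [sigma] of its predecessor. *)
Lemma time_scale_ind (P : R -> Prop) (a b : R) :
  T a -> P a ->
  (forall t, T t -> a <= t -> t < b -> P t ->
     P (sigma t) /\
     (right_dense T t ->
      \forall s \near within T (nbhs t), t < s -> s <= b -> P s)) ->
  (forall t, T t -> a < t -> t <= b -> left_dense T t ->
     (forall s, T s -> a <= s -> s < t -> P s) -> P t) ->
  forall t, T t -> a <= t -> t <= b -> P t.
Proof.
move=> Ta Pa Pright Pleft b' Tb' ab' b'b; apply: contrapT => nPb.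
set F := [set s | [/\ T s, a <= s, s <= b & ~ P s]].
have Fb : F b' by [].
have Finf : has_inf F by split; [exists b'|exists a => s []].
pose c := inf F.
have Flb s : F s -> c <= s by apply: ge_inf; case: Finf.
have ac : a <= c by apply: lb_le_inf => [|s []//]; exists b'.
have cb : c <= b by apply: le_trans b'b; exact: Flb.
have Fadh e : 0 < e -> exists2 s, F s & s < c + e by move=> e0; exact: inf_adherent.
have Tc : T c.
  apply: T_closed => U /nbhs_ballP[e /= e0 eU].
  have [s Fs se] := Fadh _ e0; have := Flb _ Fs.
  exists s; split; first by case: Fs.
  by apply: eU; rewrite /ball/= ltr_norml; lra.
have below s : T s -> a <= s -> s < c -> P s.
  move=> Ts as_ sc; apply: contrapT => nPs.
  have sb : s <= b by lra.
  by have := Flb s (And4 Ts as_ sb nPs); lra.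
have nPc : ~ P c.
  move=> Pc.
  have ltcb : c < b.
    rewrite lt_neqAle cb andbT; apply: contra_notN nPb => /eqP cEb.
    suff -> : b' = c by [].
    by apply/eqP; rewrite eq_le {1}cEb b'b Flb.
  have [Psc Prd] := Pright _ Tc ac ltcb Pc.
  have [rd|rs] := right_denseVscattered c.
    have /near_withinP[d d0 H] := Prd rd.
    have [s Fs sd] := Fadh _ d0; have cs := Flb _ Fs.
    case: Fs => Ts _ sb nPs.
    have ltcs : c < s by rewrite lt_neqAle cs andbT; apply: contra_notN nPs => /eqP <-.
    by apply: nPs; apply: H => //; rewrite ltr_norml; lra.
  have e0 : 0 < sigma c - c by lra.
  have [s Fs sd] := Fadh _ e0; have cs := Flb _ Fs.
  case: Fs => Ts _ sb nPs; apply: (@no_point_before_sigma c s) => //; last lra.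
  by rewrite lt_neqAle cs andbT; apply: contra_notN nPs => /eqP <-.
have ltac : a < c.
  by rewrite lt_neqAle ac andbT; apply: contra_notN nPc => /eqP <-.
case: (pselect (left_dense T c)) => [ld|nld]; first by apply: nPc; exact: Pleft.
have [Hmin|[r [Tr rc Hr]]] := left_scattered_pred nld; first by have := Hmin _ Ta; lra.
apply: nPc; rewrite -(sigma_pred Tc rc Hr).
have ar : a <= r by exact: Hr.
by apply: (Pright r Tr ar _ _).1; [lra|exact: below].
Qed.

(** * Calculus of delta derivatives *)

(* [delta_deriv T f t l] is convertible to
   [small t (fun s => f (sigma t) - f s - l * (sigma t - s))]. *)
Definition small t (h : R -> R) : Prop := forall e : R, 0 < e ->
  \forall s \near within T (nbhs t), `|h s| <= e * `|sigma t - s|.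

Lemma small_add t h1 h2 : small t h1 -> small t h2 ->
  small t (fun s => h1 s + h2 s).
Proof.
move=> H1 H2 e e0; have e20 : 0 < e / 2 by lra.
near=> s; rewrite /= (le_trans (ler_normD _ _))// [e]splitr mulrDl lerD//.
- by near: s; exact: H1.
- by near: s; exact: H2.
Unshelve. all: by end_near. Qed.

Lemma small_bounded_mul t k h (M : R) :
  (\forall s \near within T (nbhs t), `|k s| <= M) -> small t h ->
  small t (fun s => k s * h s).
Proof.
move=> kM H e e0.
have M0 : 0 < `|M| + 1 by rewrite ltr_wpDl.
have e20 : 0 < e / (`|M| + 1) by rewrite divr_gt0.
near=> s.
have -> : e = (`|M| + 1) * (e / (`|M| + 1)) by rewrite mulrCA divff ?mulr1// gt_eqF.
rewrite /= normrM -mulrA ler_pM//; last by near: s; exact: H.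
have : `|k s| <= M by near: s.
by have := ler_norm M; lra.
Unshelve. all: by end_near. Qed.

Lemma small_vanishing t k :
  k s @[s --> within T (nbhs t)] --> (0 : R) ->
  small t (fun s => k s * (sigma t - s)).
Proof.
move=> /cvg_withinP H e e0; near=> s.
rewrite /= normrM ler_wpM2r//.
have : `|k s - 0| <= e by near: s; exact: H.
by rewrite subr0.
Unshelve. all: by end_near. Qed.

Lemma small_ext t h1 h2 : (forall s, T s -> h1 s = h2 s) ->
  small t h1 -> small t h2.
Proof.
move=> E H e e0; have /near_withinP[d d0 Hd] := H _ e0.
by apply/near_withinP; exists d => // s Ts st; rewrite -E// Hd.
Qed.

(** The point [t] lies in its own neighbourhood, so taking [s = t] in the definition bounds the
    defect by [eps * mu t] for every [eps]. *)
Lemma delta_deriv_jump f t l : T t -> delta_deriv T f t l ->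
  f (sigma t) = f t + l * mu t.
Proof.
move=> Tt H.
have mu0 := mu_ge0 t.
have H' e : 0 < e -> `|f (sigma t) - f t - l * mu t| <= e.
  move=> e0; have mu1 : 0 < mu t + 1 by lra.
  have e'0 : 0 < e / (mu t + 1) by rewrite divr_gt0.
  have /near_withinP[d d0 Hd] := H _ e'0.
  have := Hd t Tt; rewrite subrr normr0 => /(_ d0) /le_trans; apply.
  rewrite ger0_norm// -mulrA ler_piMr//; first lra.
  by rewrite mulrC ler_pdivrMr//; rewrite /mu; lra.
have : `|f (sigma t) - f t - l * mu t| <= 0.
  by apply/ler_addgt0Pr => e /H'; rewrite add0r.
by rewrite normr_le0 => /eqP; lra.
Qed.

(** By the jump formula the terms in [mu t] cancel in [f s - f t], leaving the error of the
    derivative and [l * (s - t)]. The constants [e1] and [d2] give each of them half of [e], using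
    [|sigma t - s| <= mu t + 1] once [|s - t| < 1]. *)
Lemma delta_deriv_cvg f t l : T t -> delta_deriv T f t l ->
  f s @[s --> within T (nbhs t)] --> f t.
Proof.
move=> Tt H; have J := delta_deriv_jump Tt H; have mu0 := mu_ge0 t.
apply/cvg_withinP => e e0.
have M0 : 0 < mu t + 1 by lra.
pose e1 := e / (2 * (mu t + 1)).
have e10 : 0 < e1 by rewrite divr_gt0// mulr_gt0.
have /near_withinP[d d0 Hd] := H _ e10.
pose d2 := e / (2 * (`|l| + 1)).
have l1 : 0 < `|l| + 1 by rewrite ltr_wpDl.
have d20 : 0 < d2 by rewrite divr_gt0// mulr_gt0.
apply/near_withinP; exists (Num.min (Num.min d 1) d2).
  by rewrite !lt_min d0 d20 ltr01.
move=> s Ts; rewrite !lt_min => /andP[/andP[sd s1] sd2].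
have {}Hd := Hd s Ts sd.
have -> : f s - f t = - (f (sigma t) - f s - l * (sigma t - s)) + l * (s - t).
  by rewrite J /mu; ring.
rewrite (le_trans (ler_normD _ _))// normrN [e]splitr lerD//.
  rewrite (le_trans Hd)//.
  have -> : e / 2 = e1 * (mu t + 1) by rewrite /e1; field; rewrite gt_eqF.
  apply: ler_wpM2l; first exact: ltW.
  have -> : sigma t - s = mu t + (t - s) by rewrite /mu; ring.
  rewrite (le_trans (ler_normD _ _))// (ger0_norm mu0) lerD2l distrC; exact: ltW.
have -> : e / 2 = (`|l| + 1) * d2 by rewrite /d2; field; rewrite gt_eqF.
by rewrite normrM ler_pM//; [rewrite lerDl|exact: ltW].
Qed.

Lemma delta_deriv_cst (c : R) t : delta_deriv T (fun=> c) t 0.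
Proof.
move=> e e0; apply/near_withinP; exists 1 => // s _ _.
by rewrite subrr mul0r subr0 normr0 mulr_ge0// ltW.
Qed.

Lemma delta_derivD f g t l l' : delta_deriv T f t l -> delta_deriv T g t l' ->
  delta_deriv T (fun s => f s + g s) t (l + l').
Proof.
move=> Hf Hg; apply: small_ext (small_add Hf Hg) => s _ /=; ring.
Qed.

(** The error splits into [g s] times the error of [f], [f (sigma t)] times the error of [g], and
    [l * (g s - g t) * (sigma t - s)], which is small because [g] is continuous at [t]. *)
Lemma delta_derivM f g t l l' : T t ->
  delta_deriv T f t l -> delta_deriv T g t l' ->
  delta_deriv T (fun s => f s * g s) t (l * g t + f (sigma t) * l').
Proof.
move=> Tt Hf Hg; have Cg := delta_deriv_cvg Tt Hg.
have S1 : small t (fun s => g s * (f (sigma t) - f s - l * (sigma t - s))).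
  apply: (@small_bounded_mul _ _ _ (`|g t| + 1)) => //.
  move/cvg_withinP : Cg => /(_ 1 ltr01); apply: filterS => s.
  by have := lerB_dist (g s) (g t); lra.
have S2 : small t (fun s => l * (g s - g t) * (sigma t - s)).
  apply: small_vanishing; rewrite -[X in _ --> X](mulr0 l) -[X in l * X](subrr (g t)).
  by apply: cvgM; [exact: cvg_cst | apply: cvgB => //; exact: cvg_cst].
have S3 : small t (fun s => f (sigma t) * (g (sigma t) - g s - l' * (sigma t - s))).
  apply: (@small_bounded_mul _ _ _ `|f (sigma t)|) => //.
  by near=> s.
apply: small_ext (small_add (small_add S1 S2) S3) => s _ /=; ring.
Unshelve. all: by end_near. Qed.

Lemma delta_derivZ (c : R) f t l : delta_deriv T f t l ->
  delta_deriv T (fun s => c * f s) t (c * l).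
Proof.
move=> H; have S : small t (fun s => c * (f (sigma t) - f s - l * (sigma t - s))).
  by apply: (@small_bounded_mul _ _ _ `|c|) => //; near=> s.
apply: small_ext S => s _ /=; ring.
Unshelve. all: by end_near. Qed.

Lemma delta_deriv_sum (I : Type) (r : seq I) (f : I -> R -> R) (l : I -> R) t :
  (forall i, delta_deriv T (f i) t (l i)) ->
  delta_deriv T (fun s => \sum_(i <- r) f i s) t (\sum_(i <- r) l i).
Proof.
move=> H; elim: r => [|i r IH].
  under eq_fun do rewrite big_nil.
  rewrite big_nil; exact: delta_deriv_cst.
under eq_fun do rewrite big_cons.
by rewrite big_cons; exact: delta_derivD.
Qed.

Lemma mx_delta_derivD n m (F G : R -> 'M[R]_(n, m)) t L L' :
  mx_delta_deriv T F t L -> mx_delta_deriv T G t L' ->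
  mx_delta_deriv T (fun s => F s + G s) t (L + L').
Proof.
move=> HF HG i j; under eq_fun do rewrite mxE.
by rewrite mxE; exact: delta_derivD.
Qed.

Lemma mx_delta_deriv_cst n m (c : 'M[R]_(n, m)) t :
  mx_delta_deriv T (fun=> c) t 0.
Proof. by move=> i j; rewrite mxE; exact: delta_deriv_cst. Qed.

Lemma mx_delta_derivM n k m (F : R -> 'M[R]_(n, k)) (G : R -> 'M[R]_(k, m))
    t L L' : T t -> mx_delta_deriv T F t L -> mx_delta_deriv T G t L' ->
  mx_delta_deriv T (fun s => F s *m G s) t (L *m G t + F (sigma t) *m L').
Proof.
move=> Tt HF HG i j; under eq_fun do rewrite mxE.
by rewrite !mxE -big_split/=; apply: delta_deriv_sum => a; exact: delta_derivM.
Qed.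

Lemma mx_delta_derivMr n k m (F : R -> 'M[R]_(n, k)) (c : 'M[R]_(k, m)) t L :
  T t -> mx_delta_deriv T F t L ->
  mx_delta_deriv T (fun s => F s *m c) t (L *m c).
Proof.
move=> Tt HF; have := mx_delta_derivM Tt HF (mx_delta_deriv_cst c t).
by rewrite mulmx0 addr0.
Qed.

Lemma mx_delta_derivMl n k m (c : 'M[R]_(n, k)) (F : R -> 'M[R]_(k, m)) t L :
  T t -> mx_delta_deriv T F t L ->
  mx_delta_deriv T (fun s => c *m F s) t (c *m L).
Proof.
move=> Tt HF; have := mx_delta_derivM Tt (mx_delta_deriv_cst c t) HF.
by rewrite mul0mx add0r.
Qed.

Lemma mx_delta_deriv_jump n m (F : R -> 'M[R]_(n, m)) t L : T t ->
  mx_delta_deriv T F t L -> F (sigma t) = F t + mu t *: L.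
Proof.
move=> Tt H; apply/matrixP => i j.
by rewrite !mxE (delta_deriv_jump Tt (H i j)) mulrC.
Qed.

(** A mean value inequality, by induction along [T] with slope [k + e]: the slack [e] absorbs the
    error of the derivative at right-dense points. Continuity is a separate assumption because
    nothing is said of a derivative at [b]. *)
Lemma delta_deriv_le f (k a b : R) : T a -> T b -> a <= b ->
  (forall t, T t -> a <= t -> t < b -> exists2 l, delta_deriv T f t l & l <= k) ->
  (forall t, T t -> a <= t -> t <= b ->
     f s @[s --> within T (nbhs t)] --> f t) ->
  f b - f a <= k * (b - a).
Proof.
move=> Ta Tb ab Hd Hc.
have [->|ltab] := eqVneq a b; first by rewrite !subrr mulr0.
have {ltab} ba0 : 0 < b - a by rewrite subr_gt0 lt_neqAle ltab.
apply/ler_addgt0Pr => e0 e00.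
pose e := e0 / (b - a); have e_gt0 : 0 < e by rewrite divr_gt0.
have -> : k * (b - a) + e0 = (k + e) * (b - a) by rewrite /e; field; rewrite gt_eqF.
clearbody e => {e0 e00}.
apply: (@time_scale_ind (fun t => f t - f a <= (k + e) * (t - a)) a b) => //.
- by rewrite !subrr mulr0.
- move=> t Tt at_ tb Pt; have [l Hl lk] := Hd _ Tt at_ tb; split.
    rewrite (delta_deriv_jump Tt Hl).
    have : (k + e) * mu t >= l * mu t by rewrite ler_wpM2r ?mu_ge0//; lra.
    by rewrite {2}/mu; move: Pt; lra.
  move=> rd; have /near_withinP[d d0 H] := Hl _ e_gt0.
  apply/near_withinP; exists d => // s Ts sd ts _.
  have := H s Ts sd; rewrite rd ler_norml distrC (gtr0_norm (_ : 0 < s - t)) ?subr_gt0//.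
  have : (k + e) * (s - t) >= (l + e) * (s - t) by rewrite ler_wpM2r //; lra.
  by move: Pt; nra.
- move=> t Tt at_ tb ld Pbelow.
  apply/ler_addgt0Pr => e1 e10.
  have e120 : 0 < e1 / 2 by lra.
  have /cvg_withinP /(_ _ e120) /near_withinP [d d0 H] := Hc t Tt (ltW at_) tb.
  pose d2 := e1 / (2 * (`|k + e| + 1)).
  have ke1 : 0 < `|k + e| + 1 by rewrite ltr_wpDl.
  have d20 : 0 < d2 by rewrite divr_gt0// mulr_gt0.
  pose d' := Num.min (Num.min d (t - a)) d2.
  have d'0 : 0 < d' by rewrite !lt_min d0 d20 subr_gt0 at_.
  have [s [Ts]] := left_dense_adherent ld d'0.
  rewrite ltrBlDr -ltrBlDl !lt_min => /andP[/andP[ds sa] sd2] st.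
  have sdist : `|s - t| < d by rewrite distrC gtr0_norm//; lra.
  have as_ : a <= s by lra.
  have Ps := Pbelow s Ts as_ st.
  have := H s Ts sdist; rewrite ler_norml => /andP[H1 H2].
  have : `|(k + e) * (t - s)| <= e1 / 2.
    have -> : e1 / 2 = (`|k + e| + 1) * d2 by rewrite /d2; field; rewrite gt_eqF.
    rewrite normrM ler_pM//; first lra.
    by rewrite gtr0_norm ?subr_gt0//; exact: ltW.
  rewrite ler_norml; lra.
Qed.

Lemma delta_deriv_norm_le f (k a b : R) : T a -> T b -> a <= b ->
  (forall t, T t -> a <= t -> t < b -> exists2 l, delta_deriv T f t l & `|l| <= k) ->
  (forall t, T t -> a <= t -> t <= b ->
     f s @[s --> within T (nbhs t)] --> f t) ->
  `|f b - f a| <= k * (b - a).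
Proof.
move=> Ta Tb ab Hd Hc; rewrite ler_norml; apply/andP; split.
- have H : - 1 * f b - - 1 * f a <= k * (b - a).
    apply: (@delta_deriv_le (fun s => - 1 * f s)) => //.
      move=> t Tt at_ tb; have [l Hl lk] := Hd t Tt at_ tb.
      exists (- 1 * l); first exact: delta_derivZ.
      by rewrite mulN1r lerNl; move: lk; rewrite ler_norml => /andP[].
    by move=> t Tt at_ tb; apply: cvgM; [exact: cvg_cst|exact: Hc].
  lra.
- apply: delta_deriv_le => // t Tt at_ tb; have [l Hl lk] := Hd t Tt at_ tb.
  by exists l => //; exact: le_trans (ler_norm _) lk.
Qed.

Lemma delta_deriv_ge0_le f (a b : R) : T a -> T b -> a <= b ->
  (forall t, T t -> exists2 l, delta_deriv T f t l & 0 <= l) ->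
  f a <= f b.
Proof.
move=> Ta Tb ab Hd.
have H : - 1 * f b - - 1 * f a <= 0 * (b - a).
  apply: (@delta_deriv_le (fun s => - 1 * f s)) => //.
    move=> t Tt at_ tb; have [l Hl lk] := Hd t Tt.
    by exists (- 1 * l); [exact: delta_derivZ|lra].
  move=> t Tt at_ tb; have [l Hl lk] := Hd t Tt.
  by apply: cvgM; [exact: cvg_cst|exact: delta_deriv_cvg Hl].
lra.
Qed.

(** At a right-dense point continuity gives the bound. At a right-scattered one there are no points
    nearby on the right, so the left limit, if [t] is left-dense, and the value at [t] are
    enough. *)
Lemma rd_locally_bounded f t : rd_continuous T setT f -> T t ->
  exists2 M : R, 0 <= M & \forall s \near within T (nbhs t), `|f s| <= M.
Proof.
move=> [Hr Hl] Tt.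
have [rd|rs] := right_denseVscattered t.
  have := Hr t Tt I rd; rewrite setIT => /cvg_withinP /(_ 1 ltr01) H.
  exists (`|f t| + 1); first by rewrite addr_ge0.
  by apply: filterS H => s; have := lerB_dist (f s) (f t); lra.
have [d d0 Hd] := no_near_right rs.
have [ld|nld] := pselect (left_dense T t); last first.
  have [d' d'0 Hd'] := no_near_left nld.
  exists `|f t| => //; apply/near_withinP; exists (Num.min d d').
    by rewrite lt_min d0.
  move=> s Ts; rewrite lt_min => /andP[sd sd'].
  suff -> : s = t by [].
  by apply/eqP; rewrite eq_le Hd// Hd'.
have [l /cvg_withinP /(_ 1 ltr01) /near_withinP [d' d'0 Hd']] := Hl t Tt I ld.
exists (Num.max `|f t| (`|l| + 1)); first by rewrite le_max normr_ge0.
apply/near_withinP; exists (Num.min d d'); first by rewrite lt_min d0.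
move=> s Ts; rewrite lt_min => /andP[sd sd'].
have := Hd s Ts sd; rewrite le_eqVlt => /orP[/eqP ->|st]; first by rewrite le_max lexx.
have := Hd' s (conj (conj Ts I) st) sd'.
by rewrite le_max => H; apply/orP; right; have := lerB_dist (f s) l; lra.
Qed.

Lemma mx_rd_locally_bounded n m (F : R -> 'M[R]_(n, m)) t :
  mx_rd_continuous T setT F -> T t ->
  exists2 M : R, 0 <= M &
    \forall s \near within T (nbhs t), forall i j, `|F s i j| <= M.
Proof.
move=> HF Tt.
have /choice[M HM] : forall ij : 'I_n * 'I_m, exists M : R, 0 <= M /\
    \forall s \near within T (nbhs t), `|F s ij.1 ij.2| <= M.
  by move=> [i j]; have [M M0 H] := rd_locally_bounded (HF i j) Tt; exists M.
exists (\sum_ij M ij); first by apply: sumr_ge0 => ij _; case: (HM ij).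
have H : \forall s \near within T (nbhs t), forall ij, `|F s ij.1 ij.2| <= M ij.
  by apply: filter_forall => ij; case: (HM ij).
apply: filterS H => s H i j; rewrite (le_trans (H (i, j)))//.
by rewrite (bigD1 (i, j))//= lerDl sumr_ge0// => ij _; case: (HM ij).
Qed.

Lemma le_geometric_eq0 (y N : R) : (forall k, `|y| <= N / 2 ^+ k) -> y = 0.
Proof.
move=> H; apply/eqP; rewrite -normr_le0 leNgt; apply/negP => y0.
pose k := Num.bound (N / `|y|).
have Hk : N / `|y| < k%:R.
  by apply: le_lt_trans (archi_boundP _); rewrite ?ler_norm// divr_ge0//;
     have := H 0; rewrite expr0 divr1; apply: le_trans.
have k2 : (k%:R : R) <= 2 ^+ k by rewrite -natrX ler_nat ltnW// ltn_expl.
have := H k; rewrite ler_pdivlMr ?exprn_gt0// leNgt => /negP; apply.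
rewrite mulrC -ltr_pdivrMr//; exact: lt_le_trans k2.
Qed.

(** * Linear systems and transition matrices *)

Section LinearSystem.
Variables (n : nat) (A : R -> 'M[R]_n).
Hypothesis A_rd : mx_rd_continuous T setT A.

Lemma mx_delta_deriv_locally_bounded k (Y : R -> 'M[R]_(n, k)) t L : T t ->
  mx_delta_deriv T Y t L ->
  exists2 N : R, 0 <= N &
    \forall s \near within T (nbhs t), forall i j, `|Y s i j| <= N.
Proof.
move=> Tt HY.
exists (\sum_(ij : 'I_n * 'I_k) (`|Y t ij.1 ij.2| + 1)).
  by apply: sumr_ge0 => ij _; rewrite addr_ge0.
have H : \forall s \near within T (nbhs t), forall ij : 'I_n * 'I_k,
    `|Y s ij.1 ij.2| <= `|Y t ij.1 ij.2| + 1.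
  apply: filter_forall => ij.
  have /cvg_withinP /(_ 1 ltr01) := delta_deriv_cvg Tt (HY ij.1 ij.2).
  by apply: filterS => s; have := lerB_dist (Y s ij.1 ij.2) (Y t ij.1 ij.2); lra.
apply: filterS H => s H i j; rewrite (le_trans (H (i, j)))//.
by rewrite (bigD1 (i, j))//= lerDl sumr_ge0// => ij _; rewrite addr_ge0.
Qed.

(** On a small neighbourhood any common bound on the entries of [Y] can be halved: it bounds the
    derivative [A Y], hence, by the mean value inequality, the distance of [Y] from its value 0 at
    [t]. Iterating from a first bound [N] gives [N / 2 ^+ e] for all [e]. *)
Lemma linear_system_local_unique k (Y : R -> 'M[R]_(n, k)) t :
  (forall t, T t -> mx_delta_deriv T Y t (A t *m Y t)) ->
  T t -> Y t = 0 -> \forall s \near within T (nbhs t), Y s = 0.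
Proof.
move=> HY Tt Yt0.
have [M M0 /near_withinP[d1 d10 HM]] := mx_rd_locally_bounded A_rd Tt.
have [N N0 /near_withinP[d2 d20 HN]] := mx_delta_deriv_locally_bounded Tt (HY t Tt).
(* [c] bounds the row sums of the absolute values of [A]; the radius [d3] makes [c * d3] at most
   1/2, and the added 1 covers [c = 0]. *)
pose c := n%:R * M; have c0 : 0 <= c by rewrite mulr_ge0.
pose d3 := (2 * (c + 1))^-1.
have d30 : 0 < d3 by rewrite invr_gt0 mulr_gt0//; lra.
have cd3 : c * d3 <= 2^-1.
  rewrite /d3 -lter_pdivlMr ?invr_gt0; last by rewrite mulr_gt0//; lra.
  by rewrite invrK mulrA mulVf ?mul1r//; lra.
pose d := Num.min (Num.min d1 d2) d3.
have d0 : 0 < d by rewrite !lt_min d10 d20.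
apply/near_withinP; exists d => // s0 Ts0 s0d.
suff H : forall e s, T s -> `|s - t| < d -> forall i j, `|Y s i j| <= N / 2 ^+ e.
  apply/matrixP => i j; rewrite mxE; apply: (@le_geometric_eq0 _ N) => e.
  exact: H.
elim=> [|e IH] s Ts sd i j.
  by rewrite expr0 divr1; apply: HN => //; move: sd; rewrite !lt_min => /andP[/andP[]].
set Ne := N / 2 ^+ e in IH.
have Ne0 : 0 <= Ne by rewrite divr_ge0// exprn_ge0.
have -> : N / 2 ^+ e.+1 = Ne * 2^-1 by rewrite exprS invfM mulrCA mulrC.
have deriv r : T r -> `|r - t| < d -> `|(A r *m Y r) i j| <= c * Ne.
  move=> Tr rd; rewrite mxE (le_trans (ler_norm_sum _ _ _))//.
  have -> : c * Ne = \sum_(a < n) M * Ne.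
    by rewrite sumr_const card_ord /c -mulrA mulr_natl.
  apply: ler_sum => a _; rewrite normrM ler_pM//; last exact: IH.
  by apply: HM => //; move: rd; rewrite !lt_min => /andP[/andP[]].
have sd3 : `|s - t| <= d3.
  by move: sd; rewrite !lt_min => /andP[_ /ltW].
have Hcvg r : T r -> Y s i j @[s --> within T (nbhs r)] --> Y r i j.
  by move=> Tr; exact: delta_deriv_cvg (HY r Tr i j).
have main : `|Y s i j| <= c * Ne * `|s - t|.
  have := sd; rewrite ltr_norml => /andP[sd1 sd2].
  have [ts|st] := leP t s.
    have -> : Y s i j = Y s i j - Y t i j by rewrite Yt0 mxE subr0.
    rewrite (ger0_norm (_ : 0 <= s - t)) ?subr_ge0//.
    apply: (@delta_deriv_norm_le (fun r => Y r i j)) => //; last by move=> *; exact: Hcvg.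
    move=> r Tr tr rs; exists ((A r *m Y r) i j); first exact: HY.
    by apply: deriv => //; rewrite ltr_norml; lra.
  have -> : `|Y s i j| = `|Y t i j - Y s i j| by rewrite Yt0 mxE sub0r normrN.
  rewrite (distrC s t) (gtr0_norm (_ : 0 < t - s)) ?subr_gt0//.
  apply: (@delta_deriv_norm_le (fun r => Y r i j)) => //; first exact: ltW.
    move=> r Tr tr rs; exists ((A r *m Y r) i j); first exact: HY.
    by apply: deriv => //; rewrite ltr_norml; lra.
  by move=> *; exact: Hcvg.
rewrite (le_trans main)//.
have -> : c * Ne * `|s - t| = Ne * (c * `|s - t|) by ring.
by rewrite ler_wpM2l// (le_trans _ cd3)// ler_wpM2l.
Qed.

Hypothesis A_reg : regressive T A.

(** The zero set of [Y] is open by local uniqueness and closed by continuity. It crosses gaps both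
    ways because [Y (sigma t)] is [Y t] multiplied by the invertible matrix [1%:M + mu t *: A t]. *)
Lemma linear_system_unique k (Y : R -> 'M[R]_(n, k)) a :
  (forall t, T t -> mx_delta_deriv T Y t (A t *m Y t)) ->
  T a -> Y a = 0 -> forall t, T t -> Y t = 0.
Proof.
move=> HY Ta Ya; apply: time_scale_connected (Ta) (Ya) _ _ _ => t Tt.
- exact: linear_system_local_unique.
- move=> /eqP/matrix0Pn[i [j Yij]].
  have /cvg_withinP H := delta_deriv_cvg Tt (HY t Tt i j).
  have e0 : 0 < `|Y t i j| / 2 by rewrite divr_gt0// normr_gt0.
  apply: filterS (H _ e0) => s + Ys; rewrite {}Ys mxE sub0r normrN.
  have Y0 : 0 < `|Y t i j| by rewrite normr_gt0.
  by lra.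
- have -> : Y (sigma t) = (1%:M + mu t *: A t) *m Y t.
    by rewrite (mx_delta_deriv_jump Tt (HY t Tt)) mulmxDl mul1mx scalemxAl.
  split=> [->|H]; first by rewrite mulmx0.
  by rewrite -[Y t](mulKmx (A_reg Tt)) H mulmx0.
Qed.

Variable Phi : R -> R -> 'M[R]_n.
Hypothesis Phi_A : transition_matrix T A Phi.

(** As functions of [t], both sides solve the same linear system and agree at [t = s]. *)
Lemma transition_matrix_mul r s t : T r -> T s -> T t ->
  Phi t s *m Phi s r = Phi t r.
Proof.
move=> Tr Ts Tt; apply/eqP; rewrite -subr_eq0; apply/eqP.
apply: (@linear_system_unique _ (fun t => Phi t s *m Phi s r - Phi t r) s) => //.
  move=> {Tt}t Tt; rewrite mulmxBr mulmxA.
  have -> : (fun r0 => Phi r0 s *m Phi s r - Phi r0 r) =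
            (fun r0 => Phi r0 s *m Phi s r + Phi r0 r *m (- 1%:M)).
    by apply/funext => x; rewrite mulmxN mulmx1.
  have -> : A t *m Phi t s *m Phi s r - A t *m Phi t r =
            A t *m Phi t s *m Phi s r + A t *m Phi t r *m (- 1%:M).
    by rewrite mulmxN mulmx1.
  by apply: mx_delta_derivD; apply: mx_delta_derivMr => //; apply: (Phi_A _).2.
by rewrite (Phi_A Ts).1 mul1mx subrr.
Qed.

Lemma transition_matrixV s t : T s -> T t -> Phi t s *m Phi s t = 1%:M.
Proof. by move=> Ts Tt; rewrite transition_matrix_mul// (Phi_A Tt).1. Qed.

End LinearSystem.

(** * Antiderivatives of rd-continuous functions *)

Section Antiderivative.
Variable f : R -> R.
Hypothesis f_rd : rd_continuous T setT f.

Let before r := [set s | T s /\ s <= r].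
(** The last point of [T] up to [r]. If [r] precedes all of [T], this is the default value 0 and
    [ext] is constant there, which does no harm to its right continuity. *)
Let floorT r := sup (before r).

(* [f] made constant on the gaps of T, so that its Lebesgue integral over
   [t, sigma t[ is mu t * f t. *)
Let ext r := f (floorT r).

Let floorTP r s : T s -> s <= r ->
  [/\ T (floorT r), s <= floorT r & floorT r <= r].
Proof.
move=> Ts sr.
have E0 : before r !=set0 by exists s.
have Esup : has_sup (before r) by split=> //; exists r => x [].
split.
- apply: T_closed; apply: (@closure_subset _ (before r)) => [x []//|].
  by apply: closure_sup => //; exists r => x [].
- by apply: ub_le_sup => //; case: Esup.
- by apply: ge_sup => // x [].
Qed.

Let floorT_id t : T t -> floorT t = t.
Proof.
move=> Tt; have [_ H1 H2] := floorTP Tt (lexx t).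
by apply/eqP; rewrite eq_le H1 H2.
Qed.

Let floorT_gap r x : r <= x -> (forall s, T s -> r < s -> s <= x -> False) ->
  floorT x = floorT r.
Proof.
move=> rx H; congr sup; apply/seteqP; split=> s [Ts sx]; split=> //.
  by rewrite leNgt; apply/negP => rs; exact: (H s).
exact: le_trans rx.
Qed.

Let ext_gap t x : T t -> t <= x -> x < sigma t -> ext x = f t.
Proof.
move=> Tt tx xs; rewrite /ext (floorT_gap tx) ?floorT_id// => s Ts ts sx.
by apply: (no_point_before_sigma Ts ts); exact: le_lt_trans xs.
Qed.

(* On the left of a left-dense right-scattered point [ext] may jump, so right
   continuity is what gives measurability. *)
Let ext_right_cont r e : 0 < e ->
  exists2 d : R, 0 < d & forall x, r <= x -> x < r + d -> `|ext x - ext r| <= e.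
Proof.
move=> e0.
suff [[d d0 H]|H] : (exists2 d, 0 < d & forall s, T s -> r < s -> r + d <= s) \/
    (T r /\ right_dense T r).
- exists d => // x rx xd; rewrite /ext (floorT_gap rx) ?subrr ?normr0 ?ltW//.
  by move=> s Ts rs sx; have := H s Ts rs; lra.
- case: H => Tr rd.
  have [Hr _] := f_rd; have := Hr r Tr I rd; rewrite setIT.
  move=> /cvg_withinP /(_ e e0) /near_withinP[d d0 H]; exists d => // x rx xd.
  have [Tx x1 x2] := floorTP Tr rx; rewrite /ext (floorT_id Tr); apply: H => //.
  by rewrite ltr_norml; lra.
have [Tr|nTr] := pselect (T r).
  have [rd|rs] := right_denseVscattered r; [by right|left].
  exists (sigma r - r); first lra.
  by move=> s Ts /(sigma_le Ts); lra.
left; have /open_nbhs_nbhs/nbhs_ballP[d /= d0 H] : open_nbhs r (~` T).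
  by split=> //; exact: closed_openC.
exists d => // s Ts rs; rewrite leNgt.
apply/negP => sd; apply: (H s) => //.
by rewrite /ball/= ltr_norml; lra.
Qed.

(** The function is constant on each interval [[z / c, (z + 1) / c[] with [z] an integer, so a
    preimage is a countable union of such intervals. *)
Let measurable_floor_comp (g : int -> R) (c : R) :
  0 < c -> measurable_fun setT (fun x : R => g (Num.floor (x * c))).
Proof.
move=> c0 _ B mB; rewrite setTI.
have -> : (fun x : R => g (Num.floor (x * c))) @^-1` B =
    \bigcup_(z : int) ([set x : R | z%:~R / c <= x < (z + 1)%:~R / c] `&`
                       [set _ : R | B (g z)]).
  apply/seteqP; split=> [x /= Bx|x [z _ /= [H Bz]]].
    exists (Num.floor (x * c)) => //; split=> //=.
    by rewrite ler_pdivrMr// ltr_pdivlMr// floor_itv.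
  rewrite (_ : Num.floor (x * c) = z)//; apply: floor_def.
  by move: H; rewrite ler_pdivrMr// ltr_pdivlMr.
apply: countable_bigcupT_measurable; first exact: countableP.
move=> z; apply: measurableI.
  rewrite (_ : [set x | _] = `[(z%:~R / c), ((z + 1)%:~R / c)[%classic).
    exact: measurable_itv.
  by apply/seteqP; split=> x /=; rewrite in_itv.
have [Bz|nBz] := pselect (B (g z)).
  by rewrite (_ : [set _ | _] = setT)//; apply/seteqP; split.
by rewrite (_ : [set _ | _] = set0)//; apply/seteqP; split.
Qed.

Let measurable_ext : measurable_fun setT ext.
Proof.
(* Sampling at the right end of the cell of width [1 / k.+1] containing [x] evaluates [ext] strictly
   to the right of [x], so right continuity gives convergence to [ext x]. *)
pose h (k : nat) (x : R) : R := ext ((Num.floor (x * k.+1%:R) + 1)%:~R / k.+1%:R).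
apply: (@measurable_realfun.measurable_fun_cvg _ (measurableTypeR R) R setT h ext).
  move=> k; apply: (@measurable_floor_comp
    (fun z => ext ((z + 1)%:~R / k.+1%:R)) k.+1%:R).
  by rewrite ltr0n.
move=> x _; apply/cvgrPdist_le => e e0.
have [d d0 H] := ext_right_cont x e0.
near=> k; rewrite distrC /h; set K := k.+1%:R.
have K0 : 0 < K :> R by rewrite ltr0n.
have /andP[H1 H2] := floor_itv (x * K).
have Kd : 1 < d * K.
  rewrite -ltr_pdivrMl// mulr1 (lt_le_trans (archi_boundP _))//; last first.
    by rewrite ler_nat; near: k; exists (Num.bound d^-1) => // k /= /leqW.
  by rewrite invr_ge0 ltW.
apply: H.
  by rewrite ler_pdivlMr// ltW.
rewrite ltr_pdivrMr// mulrDl rmorphD/=.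
by rewrite ler_ltD.
Unshelve. all: by end_near. Qed.

(** Both orders of the endpoints are covered so that [time_scale_connected] can propagate the bound
    to the left as well as to the right. *)
Let bdd t t' := exists M : R, forall s, T s ->
  (t <= s <= t') || (t' <= s <= t) -> `|f s| <= M.

Let bdd_trans t t' t'' : bdd t t' -> bdd t' t'' -> bdd t t''.
Proof.
move=> [M1 H1] [M2 H2]; exists (Num.max M1 M2) => s Ts H; rewrite le_max.
have [st|st] := leP s t'; have [st2|st2] := leP t' s.
- by case/orP: H => /andP[ts st'']; rewrite H1// st st2 ?ts ?st'' ?orbT.
- case/orP: H => /andP[ts st'']; first by rewrite H1// ts st.
  by rewrite H2 ?orbT// st ts orbT.
- case/orP: H => /andP[ts st'']; first by rewrite H2 ?orbT// st2 st''.
  by rewrite H1 ?orbT// st2 st'' orbT.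
- lra.
Qed.

Let bddC t t' : bdd t t' -> bdd t' t.
Proof. by move=> [M H]; exists M => s Ts; rewrite orbC; exact: H. Qed.

Let bdd_near t : T t -> \forall s \near within T (nbhs t), bdd t s.
Proof.
move=> Tt; have [M M0 /near_withinP[d d0 H]] := rd_locally_bounded f_rd Tt.
apply/near_withinP; exists d => // s Ts sd; exists M => r Tr /orP[] /andP[r1 r2];
  by apply: H => //; move: sd; rewrite !ltr_norml; lra.
Qed.

Let bdd_sigma t : bdd t (sigma t).
Proof.
exists (Num.max `|f t| `|f (sigma t)|) => s Ts /orP[]/andP[s1 s2].
  rewrite le_max; have [->|st] := eqVneq s t; first by rewrite lexx.
  have ts : t < s by rewrite lt_neqAle eq_sym st.
  suff -> : s = sigma t by rewrite lexx orbT.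
  by apply/eqP; rewrite eq_le s2 sigma_le.
have -> : s = t by apply/eqP; rewrite eq_le s2 (le_trans (sigma_ge t)).
by rewrite le_max lexx.
Qed.

Let rd_bounded a b : T a -> T b -> bdd a b.
Proof.
move=> Ta; apply: (@time_scale_connected (bdd a) a) => //.
- by exists `|f a| => s Ts; rewrite orbb -eq_le => /eqP <-.
- move=> t Tt St; apply: filterS (bdd_near Tt) => s; exact: bdd_trans.
- move=> t Tt St; apply: filterS (bdd_near Tt) => s ts ss; apply: St.
  by apply: bdd_trans ss _; exact: bddC.
- move=> t Tt; split=> H; first exact: bdd_trans (bdd_sigma t).
  by apply: bdd_trans H _; exact/bddC/bdd_sigma.
Qed.

Local Notation leb := (@lebesgue_measure R).

Let J a b := (\int[leb]_(x in `[a, b[) ext x)%R.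

Let ext_integrable a b : T a -> T b -> leb.-integrable `[a, b[ (EFin \o ext).
Proof.
move=> Ta Tb; apply: measurable_bounded_integrable.
- exact: measurable_itv.
- by rewrite /= lebesgue_measure_itv; case: ifP => _ //=; rewrite -EFinD ltry.
- exact: measurable_funTS measurable_ext.
have [M HM] := rd_bounded Ta Tb.
exists M; split; first exact: num_real.
move=> N MN x /=; rewrite in_itv/= => /andP[ax xb].
have [Tx x1 x2] := floorTP Ta ax.
rewrite (le_trans _ (ltW MN))//; apply: HM => //.
by rewrite x1 (le_trans x2)// ltW.
Qed.

Let J_empty a b : b <= a -> J a b = 0.
Proof. by move=> ba; rewrite /J set_itv_ge ?Rintegral_set0// bnd_simp -leNgt. Qed.

Let J_chasles a b c : T a -> T b -> T c -> a <= b -> b <= c ->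
  J a c = J a b + J b c.
Proof.
move=> Ta Tb Tc ab bc.
have E : `[a, c[%classic = `[a, b[ `|` `[b, c[.
  by rewrite -itv_bndbnd_setU// bnd_simp.
rewrite /J E Rintegral_setU//; try exact: measurable_itv.
  by rewrite -E; exact: ext_integrable.
apply/disj_setPS => x [] /=; rewrite !in_itv/=; lra.
Qed.

(** Comparison with the integrals of the constants [c - e] and [c + e]. With [e = 0] it evaluates
    the integral over a gap exactly. *)
Let J_bound a b c e : T a -> T b -> a <= b ->
  (forall x, a <= x -> x < b -> `|ext x - c| <= e) ->
  `|J a b - c * (b - a)| <= e * (b - a).
Proof.
move=> Ta Tb ab H.
have cst k : (\int[leb]_(x in `[a, b[) k)%R = k * (b - a).
  rewrite Rintegral_cst ?measurable_itv//= lebesgue_measure_itv/= lte_fin.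
  by case: ltP => //= ba; rewrite (_ : b - a = 0) ?mulr0//; lra.
have icst k : leb.-integrable `[a, b[ (EFin \o (fun=> k)).
  apply: measurable_bounded_integrable.
  - exact: measurable_itv.
  - by rewrite /= lebesgue_measure_itv; case: ifP => _ //=; rewrite -EFinD ltry.
  - exact: measurable_cst.
  - exists `|k|; split; first exact: num_real.
    by move=> N kN x _; exact: ltW.
have H1 : (\int[leb]_(x in `[a, b[) (c - e))%R <= J a b.
  apply: le_Rintegral => //; [exact: ext_integrable|move=> x /=].
  by rewrite in_itv/= => /andP[ax xb]; have := H x ax xb; rewrite ler_norml; lra.
have H2 : J a b <= (\int[leb]_(x in `[a, b[) (c + e))%R.
  apply: le_Rintegral => //; [exact: ext_integrable|move=> x /=].
  by rewrite in_itv/= => /andP[ax xb]; have := H x ax xb; rewrite ler_norml; lra.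
by move: H1 H2; rewrite !cst ler_norml; lra.
Qed.

Lemma antiderivative_exists a : T a ->
  exists2 F, F a = 0 & forall t, T t -> delta_deriv T F t (f t).
Proof.
(* [J] vanishes when its endpoints are reversed, so this difference is the oriented integral from
   [a] to [t]. *)
move=> Ta; pose F t := J a t - J t a.
have FB s t : T s -> T t -> s <= t -> F t - F s = J s t.
  move=> Ts Tt st; rewrite /F; have [sa|as_] := leP s a; have [ta|at_] := leP t a.
  - by rewrite (@J_chasles s t a)// (J_empty ta) (J_empty sa); ring.
  - rewrite (@J_chasles s a t)//; last exact: ltW.
    by rewrite (J_empty (ltW at_)) (J_empty sa); ring.
  - by have := lt_le_trans as_ st; rewrite ltNge ta.
  - rewrite (@J_chasles a s t)//; last exact: ltW.
    by rewrite (J_empty (ltW at_)) (J_empty (ltW as_)); ring.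
exists F; first by rewrite /F subrr.
move=> t Tt e e0.
have [rd|rs] := right_denseVscattered t.
  have := f_rd.1 t Tt I rd; rewrite setIT.
  move=> /cvg_withinP /(_ e e0) /near_withinP[d d0 H].
  apply/near_withinP; exists d => // s Ts; rewrite ltr_norml => sd; rewrite rd.
  have [st|ts] := leP s t.
    rewrite FB// (ger0_norm (_ : 0 <= t - s)) ?subr_ge0//.
    apply: J_bound => // x sx xt; have [Tx x1 x2] := floorTP Ts sx.
    by apply: H => //; rewrite ltr_norml; lra.
  have -> : F t - F s - f t * (t - s) = - ((F s - F t) - f t * (s - t)) by ring.
  rewrite normrN (distrC t s) (FB _ _ Tt Ts (ltW ts)).
  rewrite (gtr0_norm (_ : 0 < s - t)) ?subr_gt0//.
  apply: J_bound => //; first exact: ltW.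
  move=> x sx xt; have [Tx x1 x2] := floorTP Tt sx.
  by apply: H => //; rewrite ltr_norml; lra.
have [d d0 Hright] := no_near_right rs.
have [M M0 /near_withinP[d' d'0 HM]] := rd_locally_bounded f_rd Tt.
pose K := M + `|f t| + 1; have K0 : 0 < K.
  by rewrite /K; have := normr_ge0 (f t); lra.
(* At a right-scattered point the tolerated error is at least [e * (sigma t - t)], so the crude
   bound [K * (t - s)] on the part to the left of [t] suffices for [s] close to [t]. *)
pose d2 := e * (sigma t - t) / K.
have d20 : 0 < d2 by rewrite divr_gt0// mulr_gt0// subr_gt0.
apply/near_withinP; exists (Num.min (Num.min d d') d2).
  by rewrite !lt_min d0 d'0.
move=> s Ts; rewrite !lt_min => /andP[/andP[sd sd'] sd2].
have st := Hright _ Ts sd.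
have Js : F (sigma t) - F t = f t * (sigma t - t).
  rewrite FB ?sigma_ge//; last exact: sigma_in.
  apply/eqP; rewrite -subr_eq0 -normr_le0 -[X in _ <= X](mul0r (sigma t - t)).
  apply: J_bound; rewrite ?sigma_ge//; first exact: sigma_in.
  by move=> x tx xs; rewrite (ext_gap Tt)// subrr normr0.
have -> : F (sigma t) - F s - f t * (sigma t - s) =
    (F t - F s) - f t * (t - s) by move: Js; lra.
rewrite FB//.
have : `|J s t - f t * (t - s)| <= K * (t - s).
  apply: J_bound => // x sx xt; have [Tx x1 x2] := floorTP Ts sx.
  have xM : `|ext x| <= M.
    by apply: HM => //; move: sd'; rewrite !ltr_norml; lra.
  by rewrite (le_trans (ler_normB _ _))// /K; lra.
move=> /le_trans; apply.
have h1 : K * (t - s) <= K * d2.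
  by rewrite ler_pM2l// ltW//; move: sd2; rewrite ltr_norml; lra.
rewrite (le_trans h1)// /d2 mulrC divfK ?gt_eqF// ler_pM2l//.
by rewrite ger0_norm; lra.
Qed.

End Antiderivative.

(** * Rd-continuity of matrix functions *)

Definition mx_cvg n m (F : set_system R) (M : R -> 'M[R]_(n, m)) (L : 'M[R]_(n, m)) :=
  forall i j, M s i j @[s --> F] --> L i j.

Section MatrixLimits.
Variables (F : set_system R).
Context {FF : Filter F}.

Lemma mx_cvgM n k m (M : R -> 'M[R]_(n, k)) (N : R -> 'M[R]_(k, m)) L L' :
  mx_cvg F M L -> mx_cvg F N L' -> mx_cvg F (fun s => M s *m N s) (L *m L').
Proof.
move=> HM HN i j; under eq_cvg do rewrite mxE.
rewrite mxE; apply: (cvg_big add_continuous) => a _; exact: cvgM.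
Qed.

Lemma det_cvg n (M : R -> 'M[R]_n) L :
  mx_cvg F M L -> \det (M s) @[s --> F] --> \det L.
Proof.
move=> HM; apply: (cvg_big add_continuous) => a _.
apply: cvgM; first exact: cvg_cst.
by apply: (cvg_big mul_continuous) => i _; exact: HM.
Qed.

(** By the cofactor formula an entry of the inverse is a determinant divided by a determinant, up to
    sign, and determinants pass to the limit. *)
Lemma invmx_cvg n (M : R -> 'M[R]_n) L : (forall s, M s \in unitmx) ->
  L \in unitmx -> mx_cvg F M L -> mx_cvg F (fun s => invmx (M s)) (invmx L).
Proof.
move=> Mu Lu HM i j.
have E s : invmx (M s) i j = (\det (M s))^-1 * cofactor (M s) j i.
  by rewrite /invmx Mu !mxE.
under eq_cvg do rewrite E.
rewrite {1}/invmx Lu !mxE; apply: cvgM.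
  apply: cvgV; last exact: det_cvg.
  by rewrite -unitfE -unitmxE.
apply: cvgM; first exact: cvg_cst.
apply: det_cvg => a b; rewrite !mxE; under eq_cvg do rewrite !mxE.
exact: HM.
Qed.

End MatrixLimits.

(** The left limits are collected in one function [l], so that products and inverses can be computed
    on them. *)
Definition rd_limits n m (M : R -> 'M[R]_(n, m)) (l : R -> 'M[R]_(n, m)) :=
  (forall t, T t -> right_dense T t ->
     mx_cvg (within (T `&` setT) (nbhs t)) M (M t)) /\
  (forall t, T t -> left_dense T t ->
     mx_cvg (within (T `&` setT `&` [set s | s < t]) (nbhs t)) M (l t)).

Lemma rd_limitsP n m (M : R -> 'M[R]_(n, m)) :
  mx_rd_continuous T setT M <-> exists l, rd_limits M l.
Proof.
split=> [H|[l [Hr Hl]] i j]; last first.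
  by split=> t Tt _ td; [exact: Hr|exists (l t i j); exact: Hl].
have /choice[l Hl] : forall x : R * ('I_n * 'I_m), exists l : R,
    T x.1 -> left_dense T x.1 ->
    M s x.2.1 x.2.2 @[s --> within (T `&` setT `&` [set s | s < x.1]) (nbhs x.1)]
      --> l.
  move=> [t [i j]] /=; have [Tt|nTt] := pselect (T t); last by exists 0.
  have [td|ntd] := pselect (left_dense T t); last by exists 0.
  by have [l Hl] := (H i j).2 t Tt I td; exists l.
exists (fun t => \matrix_(i, j) l (t, (i, j))); split=> t Tt td i j.
  exact: (H i j).1.
by rewrite mxE; exact: (Hl (t, (i, j))).
Qed.

Lemma mx_rd_continuousM n k m (M : R -> 'M[R]_(n, k)) (N : R -> 'M[R]_(k, m)) :
  mx_rd_continuous T setT M -> mx_rd_continuous T setT N ->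
  mx_rd_continuous T setT (fun s => M s *m N s).
Proof.
move=> /rd_limitsP[l [Mr Ml]] /rd_limitsP[l' [Nr Nl]]; apply/rd_limitsP.
exists (fun t => l t *m l' t); split=> t Tt td; apply: mx_cvgM.
- exact: Mr.
- exact: Nr.
- exact: Ml.
- exact: Nl.
Qed.

Lemma mx_rd_continuous_tr n m (M : R -> 'M[R]_(n, m)) :
  mx_rd_continuous T setT M -> mx_rd_continuous T setT (fun s => (M s)^T).
Proof. by move=> H i j; under eq_fun do rewrite mxE; exact: H. Qed.

Lemma mx_rd_continuous_cst n m (c : 'M[R]_(n, m)) :
  mx_rd_continuous T setT (fun=> c).
Proof.
move=> i j; split=> t _ _ _; last exists (c i j); exact: cvg_cst.
Qed.

(** From the left, [s <= sigma s <= t] squeezes [sigma s] to [t], so the left limit is [M t] even if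
    [t] is right-scattered. To the right of a right-dense [t], a nearby later point of [T] bounds
    [sigma s]. *)
Lemma rd_limits_comp_sigma n m (M : R -> 'M[R]_(n, m)) :
  (forall t, T t -> mx_cvg (within T (nbhs t)) M (M t)) ->
  rd_limits (M \o sigma) M.
Proof.
move=> HM; split=> t Tt td i j; have /cvg_withinP H := HM t Tt i j;
    apply/cvg_withinP => e /H /near_withinP[d d0 {}H]; apply/near_withinP.
- have [s' [Ts' ts' s'd]] := right_dense_adherent td d0.
  exists (Num.min d (s' - t)); first by rewrite lt_min d0 subr_gt0.
  move=> s [Ts _]; rewrite lt_min !ltr_norml => sd /=; rewrite td; apply: H.
    exact: sigma_in.
  have := sigma_ge s; rewrite ltr_norml; have [st|ts] := ltP s t.
    by have := sigma_le Tt st; lra.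
  by have := @sigma_le s s' Ts'; lra.
- exists d => // s [[Ts _] /= st] sd; apply: H; first exact: sigma_in.
  have := sigma_ge s; have := sigma_le Tt st; move: sd; rewrite !ltr_norml; lra.
Qed.

Lemma mx_antiderivative_exists n m (f : R -> 'M[R]_(n, m)) a :
  mx_rd_continuous T setT f -> T a ->
  exists2 F, F a = 0 & forall t, T t -> mx_delta_deriv T F t (f t).
Proof.
move=> f_rd Ta.
have /choice[F HF] : forall ij : 'I_n * 'I_m, exists F : R -> R, F a = 0 /\
    forall t, T t -> delta_deriv T F t (f t ij.1 ij.2).
  move=> [i j]; have [F Fa HF] := antiderivative_exists (f_rd i j) Ta.
  by exists F.
exists (fun t => \matrix_(i, j) F (i, j) t).
  by apply/matrixP => i j; rewrite !mxE; case: (HF (i, j)).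
move=> t Tt i j; under eq_fun do rewrite mxE.
exact: (HF (i, j)).2.
Qed.

(** * Delta derivatives of functions vanishing on the right *)

(** Values to the left of [t] never enter: the jump formula determines [l] at a right-scattered
    point, and points approaching from the right determine it at a right-dense one. *)
Lemma delta_deriv_vanish g t l : T t -> g t = 0 -> g (sigma t) = 0 ->
  (right_dense T t ->
     exists2 d : R, 0 < d & forall s, T s -> t < s -> s < t + d -> g s = 0) ->
  delta_deriv T g t l -> l = 0.
Proof.
move=> Tt gt gst gd Hl; have [rd|rs] := right_denseVscattered t; last first.
  have := delta_deriv_jump Tt Hl; rewrite gt gst add0r => /esym/eqP.
  by rewrite mulf_eq0 orbC gt_eqF /= ?subr_gt0// => /eqP.
have [d d0 H] := gd rd.
apply/eqP; rewrite -normr_le0; apply/ler_addgt0Pr => e e0; rewrite add0r.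
have /near_withinP[d' d'0 H'] := Hl e e0.
have m0 : 0 < Num.min d d' by rewrite lt_min d0.
have [s [Ts ts]] := right_dense_adherent rd m0.
rewrite -ltrBlDl lt_min => /andP[sd sd'].
have := H' s Ts; rewrite gst H//; last by rewrite -ltrBlDl.
rewrite subrr sub0r normrN normrM (gtr0_norm (_ : 0 < s - t)) ?subr_gt0// => /(_ sd').
rewrite ler_pM2r//.
by rewrite normr_gt0 rd subr_eq0 lt_eqF.
Qed.

Lemma iter_sigma_ge k t : t <= iter k sigma t.
Proof. by elim: k => //= k IH; apply: le_trans IH (sigma_ge _). Qed.

Lemma iter_sigma_le j k t : (j <= k)%N -> iter j sigma t <= iter k sigma t.
Proof. by move=> jk; rewrite -(subnK jk) iterD iter_sigma_ge. Qed.

(** Each jump costs one shrinking of the radius: a point [s'] of [T] within the previous radius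
    bounds [sigma s] for every [s < s']. *)
Lemma right_dense_iter_sigma k t (e : R) : T t -> right_dense T t -> t < e ->
  exists2 d : R, 0 < d & forall s, T s -> t < s -> s < t + d -> iter k sigma s < e.
Proof.
move=> Tt rd te; elim: k => [|k [d d0 IH]].
  by exists (e - t) => [|s Ts ts /=]; lra.
have [s' [Ts' ts' s'd]] := right_dense_adherent rd d0.
exists (s' - t); first by rewrite subr_gt0.
move=> s Ts ts ss'; rewrite iterSr; apply: IH; first exact: sigma_in.
  exact: lt_le_trans (sigma_ge s).
by have := @sigma_le s s' Ts'; lra.
Qed.

(** The derivative of order [k + 1] involves the one of order [k] at [t], at [sigma t] and just to
    the right of [t]. The induction hypothesis makes it vanish at all three, since [k] further jumps
    from there stay before [e]. *)
Lemma delta_derivn_vanish k f t (e l : R) : T t -> iter k sigma t < e ->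
  (forall s, T s -> t <= s -> s < e -> f s = 0) ->
  delta_derivn T k f t l -> l = 0.
Proof.
elim: k t l => [|k IH] t l Tt te f0 /=; first by move=> ->; exact: f0.
move=> [g [/near_withinP[d d0 gnear] gsigma Hg]].
have kt : iter k sigma t < e by apply: le_lt_trans te; exact: iter_sigma_le.
apply: delta_deriv_vanish Hg => //.
- by apply: (IH t) => //; apply: gnear => //; rewrite subrr normr0.
- apply: (IH (sigma t)) => //; first exact: sigma_in.
    by rewrite -iterSr.
  by move=> s Ts /(le_trans (sigma_ge t)); exact: f0.
- move=> rd; have te' : t < e by apply: le_lt_trans kt; exact: iter_sigma_ge.
  have [d' d'0 H'] := right_dense_iter_sigma k Tt rd te'.
  exists (Num.min d d'); first by rewrite lt_min d0.
  move=> s Ts ts; rewrite -ltrBlDl lt_min => /andP[sd sd'].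
  apply: (IH s) => //.
  + by apply: H' => //; rewrite -ltrBlDl.
  + by move=> r Tr sr; apply: f0 => //; apply: le_trans sr; exact: ltW.
  + by apply: gnear => //; rewrite gtr0_norm ?subr_gt0.
Qed.

Lemma delta_derivn0 k t : delta_derivn T k (fun=> 0) t 0.
Proof.
elim: k t => [//|k IH] t; exists (fun=> 0); split=> //; last exact: delta_deriv_cst.
by apply/near_withinP; exists 1.
Qed.

Lemma delta_derivnD k f f' t l l' :
  delta_derivn T k f t l -> delta_derivn T k f' t l' ->
  delta_derivn T k (fun s => f s + f' s) t (l + l').
Proof.
elim: k t l l' => [|k IH] t l l' /=; first by move=> -> ->.
move=> [g [gn gs Hg]] [g' [gn' gs' Hg']]; exists (fun s => g s + g' s); split.
- by apply: filterS2 gn gn' => s; exact: IH.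
- exact: IH.
- exact: delta_derivD.
Qed.

Lemma delta_derivnZ k (c : R) f t l : delta_derivn T k f t l ->
  delta_derivn T k (fun s => c * f s) t (c * l).
Proof.
elim: k t l => [|k IH] t l /=; first by move=> ->.
move=> [g [gn gs Hg]]; exists (fun s => c * g s); split.
- by apply: filterS gn => s; exact: IH.
- exact: IH.
- exact: delta_derivZ.
Qed.

Lemma mx_delta_derivnMl k n m p (c : 'M[R]_(n, m)) (F : R -> 'M[R]_(m, p)) t L :
  mx_delta_derivn T k F t L ->
  mx_delta_derivn T k (fun s => c *m F s) t (c *m L).
Proof.
move=> H i j; under eq_fun do rewrite mxE; rewrite mxE.
elim: (index_enum _) => [|a r IH].
  by under eq_fun do rewrite big_nil; rewrite big_nil; exact: delta_derivn0.
under eq_fun do rewrite big_cons; rewrite big_cons.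
by apply: delta_derivnD => //; exact: delta_derivnZ.
Qed.

(** * Controllability from the Gramian *)

Lemma gramian_unit n m (G : R -> 'M[R]_(n, m)) (W : R -> 'M[R]_n) (a b : R) :
  T a -> T b -> a <= b -> W a = 0 ->
  (forall t, T t -> mx_delta_deriv T W t (G t *m (G t)^T)) ->
  (forall v : 'rV_n,
     (forall s, T s -> a <= s -> s < b -> v *m G s = 0) -> v = 0) ->
  W b \in unitmx.
Proof.
move=> Ta Tb ab Wa HW Gfree; rewrite -row_free_unit; apply: inj_row_free => v vW.
apply: Gfree; pose phi s := (v *m W s *m v^T) 0 0.
pose sq s := \sum_j (v *m G s) 0 j ^+ 2.
have Hphi t : T t -> delta_deriv T phi t (sq t).
  move=> Tt.
  have -> : sq t = (v *m (G t *m (G t)^T) *m v^T) 0 0.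
    rewrite mulmxA -mulmxA -trmx_mul mxE; apply: eq_bigr => j _.
    by rewrite [_^T _ _]mxE expr2.
  by apply: mx_delta_derivMr => //; apply: mx_delta_derivMl => //; exact: HW.
have phi_le s t : T s -> T t -> s <= t -> phi s <= phi t.
  move=> Ts Tt st; apply: delta_deriv_ge0_le => // r Tr; exists (sq r); first exact: Hphi.
  by apply: sumr_ge0 => j _; exact: sqr_ge0.
have phi0 s : T s -> a <= s -> s <= b -> phi s = 0.
  move=> Ts as_ sb; apply/eqP; rewrite eq_le; apply/andP; split.
    by apply: le_trans (phi_le _ _ Ts Tb sb) _; rewrite /phi vW mul0mx mxE.
  by apply: le_trans (phi_le _ _ Ta Ts as_); rewrite /phi Wa mulmx0 mul0mx mxE.
move=> s Ts as_ sb.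
have sq0 : sq s = 0.
  (* As [b] is a point of [T] after [s], the jump from [s] stays in [[a, b]], where [phi] is 0; at
     [s = b] it would leave this interval when [b] is right-scattered. *)
  have ssb : sigma s <= b by exact: sigma_le.
  apply: delta_deriv_vanish (Hphi s Ts) => //.
  - by apply: phi0 => //; exact: ltW.
  - by apply: phi0 => //; [exact: sigma_in|exact: le_trans (sigma_ge s)].
  - move=> _; exists (b - s); first by rewrite subr_gt0.
    by move=> r Tr sr rb; apply: phi0 => //; lra.
apply/rowP => j; rewrite [RHS]mxE; apply/eqP; rewrite -sqrf_eq0.
by have /psumr_eq0P := sq0; move=> -> // i _; exact: sqr_ge0.
Qed.

Section Controllability.
Variables (n m p : nat) (A : R -> 'M[R]_n) (B : R -> 'M[R]_(n, m)).
Variables (C : R -> 'M[R]_(p, n)) (D : R -> 'M[R]_(p, m)).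
Hypotheses (A_rd : mx_rd_continuous T setT A) (B_rd : mx_rd_continuous T setT B).
Hypothesis A_reg : regressive T A.
Variable Phi : R -> R -> 'M[R]_n.
Hypothesis Phi_A : transition_matrix T A Phi.

(** This exchanges the two arguments, regularity of [Phi] being available only in the first. *)
Lemma Phi_sigma_invmx a s : T a ->
  Phi (sigma s) a \in unitmx /\ Phi a (sigma s) = invmx (Phi (sigma s) a).
Proof.
move=> Ta; have Ts := sigma_in s.
have H := transition_matrixV A_rd A_reg Phi_A Ts Ta.
have [U1 U2] := mulmx1_unit H; split=> //.
by rewrite -[RHS]mul1mx -H -mulmxA mulmxV// mulmx1.
Qed.

Lemma mx_rd_continuous_Phi_sigma a : T a ->
  mx_rd_continuous T setT (fun s => Phi a (sigma s)).
Proof.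
move=> Ta; apply/rd_limitsP.
have -> : (fun s => Phi a (sigma s)) = (fun s => invmx (Phi (sigma s) a)).
  by apply/funext => s; exact: (Phi_sigma_invmx s Ta).2.
have Hcvg t : T t -> mx_cvg (within T (nbhs t)) (Phi^~ a) (Phi t a).
  by move=> Tt i j; exact: delta_deriv_cvg ((Phi_A Ta).2 t Tt i j).
have [Hr Hl] := rd_limits_comp_sigma Hcvg.
have U s : Phi (sigma s) a \in unitmx by case: (Phi_sigma_invmx s Ta).
exists (fun t => invmx (Phi t a)); split=> t Tt td.
- by apply: invmx_cvg => //; exact: Hr.
- apply: invmx_cvg => //; last exact: Hl.
  by have /mulmx1_unit[] := transition_matrixV A_rd A_reg Phi_A Ta Tt.
Qed.

Lemma controllable_of_gramian t0 tf : T t0 -> T tf -> t0 < tf ->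
  (forall v : 'rV_n, (forall s, T s -> t0 <= s -> s < tf ->
     v *m (Phi t0 (sigma s) *m B s) = 0) -> v = 0) ->
  controllable T A B C D t0 tf.
Proof.
move=> Tt0 Ttf t0tf Gfree x0 xf.
pose G s := Phi t0 (sigma s) *m B s.
have G_rd : mx_rd_continuous T setT G.
  by apply: mx_rd_continuousM => //; exact: mx_rd_continuous_Phi_sigma.
have GT_rd := mx_rd_continuous_tr G_rd.
have [W W0 HW] := mx_antiderivative_exists (mx_rd_continuousM G_rd GT_rd) Tt0.
have Wunit : W tf \in unitmx by apply: gramian_unit HW Gfree => //; exact: ltW.
pose zeta := Phi t0 tf *m xf - x0.
pose c := invmx (W tf) *m zeta.
pose u s := (G s)^T *m c.
pose x t := Phi t t0 *m (x0 + W t *m c).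
exists u, x, (fun t => C t *m x t + D t *m u t); split.
- by apply: mx_rd_continuousM => //; exact: mx_rd_continuous_cst.
- split=> //; first by rewrite /x W0 mul0mx addr0 (Phi_A Tt0).1 mul1mx.
  move=> t Tt.
  (* This is the form produced by the product rule: [Phi (sigma t) t0] cancels the factor
     [Phi t0 (sigma t)] of [G t] and leaves [B t *m u t]. *)
  have -> : A t *m x t + B t *m u t =
      A t *m Phi t t0 *m (x0 + W t *m c) +
      Phi (sigma t) t0 *m (0 + G t *m (G t)^T *m c).
    rewrite /x /u add0r mulmxA; congr (_ + _).
    rewrite /G -!mulmxA [in RHS]mulmxA (transition_matrixV A_rd A_reg Phi_A)//.
      by rewrite mul1mx.
    exact: sigma_in.
  apply: mx_delta_derivM => //; first exact: (Phi_A Tt0).2.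
  apply: mx_delta_derivD; first exact: mx_delta_deriv_cst.
  by apply: mx_delta_derivMr => //; exact: HW.
- rewrite /x /c mulmxA mulmxV// mul1mx /zeta addrC subrK mulmxA.
  by rewrite (transition_matrixV A_rd A_reg Phi_A)// mul1mx.
Qed.

Lemma annihilates_K (K : nat -> 'M[R]_(n, m)) (t0 tf tc : R) (q : nat)
    (v : 'rV[R]_n) :
  T t0 -> T tc -> t0 <= tc -> iter q sigma tc < tf ->
  (forall j, (j <= q)%N -> is_K T B Phi j tc (K j)) ->
  (forall s, T s -> t0 <= s -> s < tf ->
     v *m (Phi t0 (sigma s) *m B s) = 0) ->
  forall j, (j <= q)%N -> v *m Phi t0 (sigma tc) *m K j = 0.
Proof.
move=> Tt0 Ttc t0tc qtf HK Hv j jq; apply/matrixP => a b; rewrite [RHS]mxE.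
have := mx_delta_derivnMl (v *m Phi t0 (sigma tc)) (HK j jq) => /(_ a b).
apply: delta_derivn_vanish => //.
  by apply: le_lt_trans qtf; exact: iter_sigma_le.
move=> s Ts tcs stf; rewrite mulmxA -(mulmxA v).
rewrite (transition_matrix_mul A_rd A_reg Phi_A)//.
- by rewrite -mulmxA Hv// ?mxE//; exact: le_trans tcs.
- exact: sigma_in.
- exact: sigma_in.
Qed.

End Controllability.
End TimeScaleTheory.

Theorem theorem2p4 (R : realType) (T : set R)
  (T_ts : time_scale T) (T_ub : unbounded_above T)
  (T_mu : bounded_graininess T)
  (t0 tf : R) (T_t0 : T t0) (T_tf : T tf) (t0_lt_tf : t0 < tf)
  (n m p : nat) (p_le_n : (p <= n)%N) (m_le_n : (m <= n)%N)
  (A : R -> 'M[R]_n) (B : R -> 'M[R]_(n, m))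
  (C : R -> 'M[R]_(p, n)) (D : R -> 'M[R]_(p, m))
  (A_rd : mx_rd_continuous T setT A) (B_rd : mx_rd_continuous T setT B)
  (C_rd : mx_rd_continuous T setT C) (D_rd : mx_rd_continuous T setT D)
  (A_reg : regressive T A)
  (q : nat) (q_gt0 : (0 < q)%N)
  (B_diff : mx_rd_differentiable T `[t0, tf] q B)
  (mu_diff : rd_differentiable T `[t0, tf] q.-1 (mu T))
  (A_diff : mx_rd_differentiable T `[t0, tf] q.-1 A)
  (Phi : R -> R -> 'M[R]_n) (Phi_A : transition_matrix T A Phi) :
  (exists tc : R, [/\ T tc, t0 <= tc, tc < tf,
     (* the forward jumps sampled by the derivatives up to order q at tc stay
        before tf; automatic if tc is right-dense or tf is left-dense, and
        needed otherwise *)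
     iter q (sigma T) tc < tf
   & exists K : nat -> 'M[R]_(n, m),
       (forall j, (j <= q)%N -> is_K T B Phi j tc (K j)) /\
       \rank (mxrow (fun j : 'I_q.+1 => K j)) = n]) ->
  controllable T A B C D t0 tf.
Proof.
have [_ T_closed] := T_ts.
move=> [tc [T_tc t0_tc tc_tf q_tf [K [HK rankK]]]].
apply: (controllable_of_gramian T_closed T_ub C D A_rd B_rd A_reg Phi_A) => //.
move=> v Hv; set w := v *m Phi t0 (sigma T tc).
have wK := annihilates_K T_closed T_ub A_rd A_reg Phi_A T_t0 T_tc t0_tc q_tf HK Hv.
have w0 : w = 0.
  have Kfree : row_free (mxrow (fun j : 'I_q.+1 => K j)).
    by rewrite -row_leq_rank rankK.
  apply: (row_free_inj Kfree); rewrite mul0mx mul_mxrow -[RHS]mxrow0.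
  by apply/eq_mxrow => j; apply: wK; rewrite -ltnS.
(* The row [v] is recovered from [w] by multiplication with [Phi (sigma T tc) t0], the inverse of
   [Phi t0 (sigma T tc)]. *)
have T_s := sigma_in T_closed T_ub tc.
have := transition_matrixV T_closed T_ub A_rd A_reg Phi_A T_s T_t0.
by rewrite -[v]mulmx1 => <-; rewrite mulmxA -/w w0 mul0mx.
Qed.
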